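(* Let $R$ be a proper normed division ring, let $M$ be a Polish $R$-vector space, and let $N\subseteq M$ be an $F_\sigma$ vector subspace. Then exactly one of the following holds: (1) $\dim_R(M/N)$ is countable; (2) $\ell^1(R)\sqsubseteq^R M/N$, i.e. there is a continuous $R$-linear map $\ell^1(R)\to M$ such that the composite $\ell^1(R)\to M\to M/N$ is injective.
   Context: All rings are unital. A norm on an abelian group $A$ is a function $\|\cdot\|\colon A\to[0,\infty)$ such that $(a,b)\mapsto\|a-b\|$ is a metric on $A$; it is proper if every closed ball of this metric is compact. A norm on a ring $R$ is a norm $|\cdot|$ on $(R,+)$ with $|rs|\le|r||s|$; a proper normed ring is a ring with a proper norm, topologized by the associated metric. A division ring is a ring in which every nonzero element has a two-sided inverse. For a Polish ring $R$, a Polish $R$-module is a topological left $R$-module whose topology is Polish. For proper normed $R$, $\ell^1(R)=\{(r_k)_{k\in\mathbb N}\in R^{\mathbb N}:\sum_k |r_k|/k!<\infty\}$ with norm $\|(r_k)_k\|=\sum_k|r_k|/k!$, a Polish $R$-module. For Polish $R$-modules $M_0,M_1$ with Baire-measurable submodules $N_0,N_1$, write $M_0/N_0\sqsubseteq^R M_1/N_1$ if there is a continuous linear map $M_0\to M_1$ which descends to an injection $M_0/N_0\hookrightarrow M_1/N_1$; a module $M$ alone is identified with $M/0$. *)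

(* Defs.v *)
From HB Require Import structures.
From mathcomp Require Import all_boot all_order all_algebra.
From mathcomp Require Import all_classical all_reals.
From mathcomp Require Import ereal topology normedtype sequences.
From mathcomp Require Import Rstruct.
Set Implicit Arguments. Unset Strict Implicit. Unset Printing Implicit Defensive.
Import Order.TTheory GRing.Theory Num.Theory.
Local Open Scope ring_scope.
Local Open Scope classical_set_scope.

Notation real := Rdefinitions.R.

Definition is_metric (T : Type) (d : T -> T -> real) : Prop :=
  (forall x y, 0 <= d x y) /\
  (forall x y, d x y = 0 <-> x = y) /\
  (forall x y, d x y = d y x) /\
  (forall x y z, d x z <= d x y + d y z).

Definition mopen (T : Type) (d : T -> T -> real) (U : set T) : Prop :=
  forall x, U x -> exists2 e : real, 0 < e & forall y, d x y < e -> U y.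

Definition mclosed (T : Type) (d : T -> T -> real) (C : set T) : Prop :=
  forall x, (forall e : real, 0 < e -> exists2 y, C y & d x y < e) -> C x.

Definition mcompact (T : Type) (d : T -> T -> real) (K : set T) : Prop :=
  forall (I : Type) (U : I -> set T), (forall i, mopen d (U i)) ->
    K `<=` \bigcup_(i in [set: I]) U i ->
    exists (n : nat) (f : 'I_n -> I), K `<=` \bigcup_(j in [set: 'I_n]) U (f j).

Definition closed_ball_m (T : Type) (d : T -> T -> real) (x : T) (r : real) : set T :=
  [set y | d x y <= r].

Definition proper_metric (T : Type) (d : T -> T -> real) : Prop :=
  forall x r, mcompact d (closed_ball_m d x r).

Definition complete_metric (T : Type) (d : T -> T -> real) : Prop :=
  forall u : nat -> T,
    (forall e : real, 0 < e -> exists N, forall m n, (N <= m)%N -> (N <= n)%N -> d (u m) (u n) < e) ->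
    exists l, forall e : real, 0 < e -> exists N, forall n, (N <= n)%N -> d l (u n) < e.

Definition separable_metric (T : Type) (d : T -> T -> real) : Prop :=
  exists u : nat -> T, forall x (e : real), 0 < e -> exists n, d x (u n) < e.

Definition is_norm (A : zmodType) (nrm : A -> real) : Prop :=
  (forall a, 0 <= nrm a) /\ is_metric (fun a b => nrm (a - b)).

Definition is_ring_norm (R : nzRingType) (nrm : R -> real) : Prop :=
  is_norm nrm /\ (forall r s, nrm (r * s) <= nrm r * nrm s).

Definition is_division_ring (R : nzRingType) : Prop :=
  forall r : R, r != 0 -> exists s : R, s * r = 1 /\ r * s = 1.

(* The topology of M is the one induced by the metric dM, which is required to
   be complete and separable (so the topology is Polish), and the module
   operations must be continuous (R carries the topology of its norm). *)
Definition topological_module (R : nzRingType) (nrm : R -> real)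
    (M : lmodType R) (dM : M -> M -> real) : Prop :=
  (forall (x y : M) (e : real), 0 < e -> exists2 del : real, 0 < del &
     forall x' y', dM x x' < del -> dM y y' < del -> dM (x + y) (x' + y') < e) /\
  (forall (x : M) (e : real), 0 < e -> exists2 del : real, 0 < del &
     forall x', dM x x' < del -> dM (- x) (- x') < e) /\
  (forall (a : R) (x : M) (e : real), 0 < e -> exists2 del : real, 0 < del &
     forall a' x', nrm (a - a') < del -> dM x x' < del -> dM (a *: x) (a' *: x') < e).

Definition polish_module (R : nzRingType) (nrm : R -> real)
    (M : lmodType R) (dM : M -> M -> real) : Prop :=
  [/\ is_metric dM, complete_metric dM, separable_metric dM & topological_module nrm dM].

Definition Fsigma (T : Type) (d : T -> T -> real) (N : set T) : Prop :=
  exists C : nat -> set T, (forall n, mclosed d (C n)) /\ N = \bigcup_(n in [set: nat]) C n.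

Definition lincomb (R : nzRingType) (M : lmodType R) (s : seq (R * M)) : M :=
  \sum_(p <- s) p.1 *: p.2.

(* B is (a set of representatives of) a basis of M/N *)
Definition basis_mod (R : nzRingType) (M : lmodType R) (N : {pred M}) (B : set M) : Prop :=
  (forall x : M, exists s : seq (R * M),
      (forall p, p \in s -> B p.2) /\ x - lincomb s \in N) /\
  (forall s : seq (R * M),
      (forall p, p \in s -> B p.2) -> uniq (map snd s) ->
      lincomb s \in N -> forall p, p \in s -> p.1 = 0).

Definition countable_dim_quot (R : nzRingType) (M : lmodType R) (N : {pred M}) : Prop :=
  exists B : set M, (exists f : nat -> M, B `<=` range f) /\ basis_mod N B.

Definition l1_terms (R : nzRingType) (nrm : R -> real) (r : nat -> R) (k : nat) : real :=
  nrm (r k) / (k`!)%:R.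

Definition in_l1 (R : nzRingType) (nrm : R -> real) (r : nat -> R) : Prop :=
  (\sum_(k <oo) (l1_terms nrm r k)%:E < +oo)%E.

Definition l1_norm (R : nzRingType) (nrm : R -> real) (r : nat -> R) : real :=
  fine (\sum_(k <oo) (l1_terms nrm r k)%:E)%E.

Definition l1_embeds (R : nzRingType) (nrm : R -> real) (M : lmodType R)
    (dM : M -> M -> real) (N : {pred M}) : Prop :=
  exists T : (nat -> R) -> M,
    [/\
        (forall (a : R) (r s : nat -> R), in_l1 nrm r -> in_l1 nrm s ->
           T (fun k => a * r k + s k) = a *: T r + T s),
        (forall r : nat -> R, in_l1 nrm r -> forall e : real, 0 < e ->
           exists2 del : real, 0 < del & forall s, in_l1 nrm s ->
             l1_norm nrm (fun k => r k - s k) < del -> dM (T r) (T s) < e) &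
        (forall r s : nat -> R, in_l1 nrm r -> in_l1 nrm s ->
           T r - T s \in N -> r = s)].

(* Main.v *)
(* Suppose M/N has uncountable dimension.  By separability no neighbourhood of 0
   is contained in N plus the span of a finite set: that sum would be an open
   subgroup, of countable index.  So one can choose x_0, x_1, ... linearly
   independent modulo N and tending to 0 as fast as desired.  Write N as a union
   of closed sets C_m.  The coefficient vectors (r_0, ..., r_k) with
   |r_i| <= (k+1) i! and some |r_j| >= 1/(k+1) form a compact set whose image
   under r |-> sum_i r_i x_i avoids N, hence stays at positive distance from
   C_0, ..., C_k; choosing the later x_i small enough, the infinite sum stays away
   from these sets as well.  Hence r |-> sum_i r_i x_i is defined and continuous
   on l^1(R) and injective modulo N.

   Conversely l^1(R) contains an independent family indexed by {0,1}^nat, the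
   indicators of the sets of finite prefixes of binary sequences, whereas in a
   space of countable dimension an independent family is a countable union of
   finite sets. *)
Require Import Defs.
From HB Require Import structures.
From mathcomp Require Import all_boot all_order all_algebra.
From mathcomp Require Import all_classical all_reals.
From mathcomp Require Import ereal topology normedtype sequences.
From mathcomp Require Import Rstruct.
From mathcomp Require Import lra zify.
Import Order.TTheory GRing.Theory Num.Theory.
Local Open Scope ring_scope.

(** * Linear algebra modulo a submodule *)

Section DivisionRing.
Context {R : nzRingType} (Rdiv : is_division_ring R).

(** Gaussian elimination by induction on [n]: a row [p] with [c p n != 0] clears column [n] in the
    other rows, and a relation among the reduced rows extends to the original ones. Coefficients
    stay on the left, as [R] need not be commutative. *)
Lemma exists_left_relation (I : finType) (n : nat) (P : {set I})
    (c : I -> nat -> R) : (n < #|P|)%N ->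
  exists a : I -> R, (exists2 i, i \in P & a i != 0) /\
    forall j, (j < n)%N -> \sum_(i in P) a i * c i j = 0.
Proof.
elim: n P c => [|n IHn] P c ltnP.
  have /card_gt0P[i Pi] := ltnP.
  by exists (fun=> 1); split=> //; exists i; rewrite ?oner_neq0.
have [[p Pp cpn]|c0] := pselect (exists2 p, p \in P & c p n != 0); last first.
  have [a [a0 aP]] := IHn P c (ltnW ltnP).
  exists a; split=> // j; rewrite ltnS leq_eqVlt => /predU1P[->|/aP//].
  apply: big1 => i Pi; have [->|cin] := eqVneq (c i n) 0; first by rewrite mulr0.
  by case: c0; exists i.
have [e [ec _]] := Rdiv _ cpn.
have ltnP' : (n < #|P :\ p|)%N by rewrite (cardsD1 p P) Pp in ltnP.
have [a [[i0 Pi0 ai0] aP]] :=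
  IHn (P :\ p) (fun i j => c i j - c i n * e * c p j) ltnP'.
have [i0p Pi0'] := setD1P Pi0.
(* The pivot row collects all the multiples of it that were subtracted from the other rows. *)
pose ap := - \sum_(i in P :\ p) a i * (c i n * e).
exists (fun i => if i == p then ap else a i); split.
  by exists i0 => //; rewrite (negPf i0p).
move=> j ltjn; rewrite (big_setD1 p) //= eqxx.
under eq_bigr => i /setD1P[/negPf-> _] do over.
have -> : ap * c p j + \sum_(i in P :\ p) a i * c i j =
    \sum_(i in P :\ p) a i * (c i j - c i n * e * c p j).
  rewrite /ap mulNr mulr_suml addrC -sumrB; apply: eq_bigr => i _.
  by rewrite mulrBr !mulrA.
move: ltjn; rewrite ltnS leq_eqVlt => /predU1P[->|/aP//].
by apply: big1 => i _; rewrite -!mulrA ec mulr1 subrr mulr0.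
Qed.

End DivisionRing.

(** * Finite linear combinations and spans modulo a submodule *)

Section SpanModulo.
Context {R : nzRingType} {M : lmodType R} (N : submodClosed M).
Implicit Types (f x : nat -> M) (r s : nat -> R).

(** Families and coefficients are total functions on [nat] cut off at [n], so the same [x] and [r]
    serve for every partial sum. *)
Definition lin_sum (n : nat) x r : M := \sum_(i < n) r i *: x i.

Definition span_mod f (n : nat) : set M :=
  [set y | exists c : nat -> R, y - lin_sum n f c \in N]%classic.

Definition free_mod (n : nat) x : Prop :=
  forall r, lin_sum n x r \in N -> forall i, (i < n)%N -> r i = 0.

(** Countable dimension without the independence requirement; the two agree over a division ring,
    and the analytic arguments work with this form. *)
Definition countably_spanned : Prop :=
  exists f : nat -> M, forall y, exists n, span_mod f n y.

Lemma eq_lin_sum n x x' r r' :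
  (forall i, (i < n)%N -> r i = r' i) -> (forall i, (i < n)%N -> x i = x' i) ->
  lin_sum n x r = lin_sum n x' r'.
Proof. by move=> er ex; apply: eq_bigr => i _; rewrite er ?ex. Qed.

Lemma lin_sumS n x r : lin_sum n.+1 x r = lin_sum n x r + r n *: x n.
Proof. by rewrite /lin_sum big_ord_recr. Qed.

Lemma lin_sum_linear n x a r s :
  lin_sum n x (fun i => a * r i + s i) = a *: lin_sum n x r + lin_sum n x s.
Proof.
rewrite /lin_sum scaler_sumr -big_split; apply: eq_bigr => i _ /=.
by rewrite scalerDl scalerA.
Qed.

Lemma span_mod_linear f n a y z :
  span_mod f n y -> span_mod f n z -> span_mod f n (a *: y + z).
Proof.
move=> [c yc] [d zd].
exists (fun i => a * c i + d i); rewrite lin_sum_linear opprD addrACA.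
by rewrite -scalerBr rpredD ?rpredZ.
Qed.

Lemma span_mod_widen f n m y : (n <= m)%N -> span_mod f n y -> span_mod f m y.
Proof.
move=> lenm [c yc]; exists (fun i => if (i < n)%N then c i else 0).
suff <- : lin_sum n f c = lin_sum m f (fun i => if (i < n)%N then c i else 0) by [].
rewrite /lin_sum (big_ord_widen m (fun i => c i *: f i) lenm) big_mkcond.
by apply: eq_bigr => i _; case: ifP; rewrite ?scale0r.
Qed.

Lemma mem_span_mod f n y : y \in N -> span_mod f n y.
Proof.
move=> Ny; exists (fun=> 0); rewrite /lin_sum big1 ?subr0 // => i _.
by rewrite scale0r.
Qed.

Lemma gen_span_mod f n i : (i < n)%N -> span_mod f n (f i).
Proof.
move=> ltin; exists (fun j => (j == i)%:R).
rewrite /lin_sum (bigD1 (Ordinal ltin)) //= eqxx scale1r big1 ?addr0 ?subrr //.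
  exact: rpred0.
by move=> j /negPf; rewrite -val_eqE /= => ->; rewrite scale0r.
Qed.

End SpanModulo.

(** * Bases of the quotient and countable spanning families *)

Section Basis.
Context {R : nzRingType} (Rdiv : is_division_ring R).
Context {M : lmodType R} (N : submodClosed M).

(** A relation with [r n != 0] could be solved for [x n] by a left inverse of [r n]. *)
Lemma free_modS n (x : nat -> M) :
  free_mod N n x -> ~ span_mod N x n (x n) -> free_mod N n.+1 x.
Proof.
move=> freex xn r; rewrite lin_sumS => Nr.
have [rn0|rn0] := eqVneq (r n) 0.
  move=> i; rewrite ltnS leq_eqVlt => /predU1P[->//|ltin].
  by apply: freex ltin; rewrite rn0 scale0r addr0 in Nr.
case: xn; have [e [er _]] := Rdiv _ rn0.
exists (fun i => - e * r i + 0).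
rewrite lin_sum_linear /lin_sum [X in _ - (_ + X)]big1 ?addr0; last first.
  by move=> i _; rewrite scale0r.
by rewrite scaleNr opprK -[x n]scale1r -er -scalerA -scalerDr addrC rpredZ.
Qed.

Lemma lincomb_cons p (s : seq (R * M)) :
  lincomb (p :: s) = p.1 *: p.2 + lincomb s.
Proof. by rewrite /lincomb big_cons. Qed.

Lemma countable_dim_countably_spanned :
  countable_dim_quot N -> countably_spanned N.
Proof.
move=> [B [[f Bf] [Bspan _]]]; exists f => y; have [s [sB Ns]] := Bspan y.
suff [n sn] : exists n, span_mod N f n (lincomb s).
  exists n; have := span_mod_linear N f n 1 _ _ sn (mem_span_mod N f n _ Ns).
  by rewrite scale1r addrC subrK.
elim: s sB {Ns} => [_|p s IHs sB].
  by exists 0; apply: mem_span_mod; rewrite /lincomb big_nil rpred0.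
have [|n sn] := IHs; first by move=> q qs; apply: sB; rewrite inE qs orbT.
have /sB/Bf[m _ fm] := mem_head p s.
exists (maxn n m.+1); rewrite lincomb_cons; apply: span_mod_linear.
  by rewrite -fm; apply: gen_span_mod; rewrite leq_max ltnSn orbT.
by apply: span_mod_widen sn; rewrite leq_maxl.
Qed.

(** The basis consists of those [f n] outside the span of [N] and their predecessors. In a relation
    among them the vector of largest index has coefficient zero, and induction on a bound [K] for
    the indices removes it. *)
Lemma countably_spanned_countable_dim :
  countably_spanned N -> countable_dim_quot N.
Proof.
move=> [f spanf].
pose good n := ~ span_mod N f n (f n).
exists [set y | exists n, y = f n /\ good n]%classic.
split; first by exists f => _ [n [-> _]]; exists n.
split.
  pose spanB y := exists s : seq (R * M),
    (forall p, p \in s -> exists n, p.2 = f n /\ good n) /\ y - lincomb s \in N.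
  have spanB_linear a y z : spanB y -> spanB z -> spanB (a *: y + z).
    move=> [s [sB ys]] [t [tB zt]].
    exists ([seq (a * p.1, p.2) | p <- s] ++ t); split.
      by move=> p; rewrite mem_cat => /orP[/mapP[q qs ->]|/tB//]; exact: sB qs.
    rewrite /lincomb big_cat big_map /=.
    under eq_bigr do rewrite -scalerA.
    by rewrite -scaler_sumr opprD addrACA -scalerBr rpredD ?rpredZ.
  suff spanB_f n y : span_mod N f n y -> spanB y.
    by move=> y; have [n yn] := spanf y; apply: spanB_f yn.
  elim: n y => [|n IHn] y [c yc].
    by exists [::]; split; rewrite // /lincomb big_nil; rewrite /lin_sum big_ord0 in yc.
  (* A rejected [f n] is covered by its predecessors; an accepted one represents itself. *)
  have fn : spanB (f n).
    have [/IHn//|fn] := pselect (span_mod N f n (f n)).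
    exists [:: (1, f n)]; split; last by rewrite /lincomb big_seq1 scale1r subrr rpred0.
    by move=> p; rewrite inE => /eqP->; exists n.
  rewrite -[y](subrK (c n *: f n)) addrC; apply: spanB_linear fn _.
  by apply: IHn; exists c; move: yc; rewrite lin_sumS opprD addrA addrAC.
move=> s sB; have [K sK] : exists K, forall p, p \in s ->
    exists n, [/\ (n < K)%N, p.2 = f n & good n].
  elim: s sB => [_|p s IHs sB]; first by exists 0.
  have [|K sK] := IHs; first by move=> q qs; apply: sB; rewrite inE qs orbT.
  have [n [pn gn]] := sB p (mem_head p s).
  exists (maxn K n.+1) => q; rewrite inE => /predU1P[->|/sK[m [mK qm gm]]].
    by exists n; rewrite leq_max ltnSn orbT.
  by exists m; rewrite leq_max mK.
elim: K s {sB} sK => [|K IHK] s sK us Ns p ps; first by have [n []] := sK p ps.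
have [[q [qs qK gK]]|noK] :=
    pselect (exists q, [/\ q \in s, q.2 = f K & good K]); last first.
  apply: IHK us Ns p ps => q qs; have [n [ltnK qn gn]] := sK q qs.
  exists n; split=> //; move: ltnK; rewrite ltnS leq_eqVlt => /predU1P[nK|//].
  by case: noK; exists q; rewrite -nK.
have sq := perm_to_rem qs.
have := perm_map snd sq => /perm_uniq; rewrite us /= => /esym/andP[qnotin urem].
(* The vectors are pairwise distinct, so index [K] cannot occur a second time. *)
have remK t : t \in rem q s -> exists n, [/\ (n < K)%N, t.2 = f n & good n].
  move=> tq; have [n [ltnK tn gn]] := sK t (mem_rem tq).
  exists n; split=> //; move: ltnK; rewrite ltnS leq_eqVlt => /predU1P[nK|//].
  by case/negP: qnotin; rewrite qK -nK -tn; apply: map_f.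
have Nq : q.1 *: q.2 + lincomb (rem q s) \in N.
  by rewrite -lincomb_cons /lincomb -(perm_big _ sq).
have remspan : span_mod N f K (lincomb (rem q s)).
  elim: (rem q s) remK => [_|t u IHu uK].
    by apply: mem_span_mod; rewrite /lincomb big_nil rpred0.
  rewrite lincomb_cons; apply: span_mod_linear.
    have [n [ltnK -> _]] := uK t (mem_head t u).
    exact: gen_span_mod.
  by apply: IHu => v vu; apply: uK; rewrite inE vu orbT.
have q0 : q.1 = 0.
  apply/eqP/negP => /negP q0; apply: gK; have [e [eq _]] := Rdiv _ q0.
  rewrite -[f K]scale1r -eq -scalerA -qK -[_ *: q.2](addrK (lincomb (rem q s))).
  rewrite addrC scalerDr scalerN -scaleNr; apply: span_mod_linear => //.
  by apply: mem_span_mod; rewrite rpredZ.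
move: ps; rewrite (perm_mem sq) inE => /predU1P[->//|].
apply: IHK remK urem _ p.
by move: Nq; rewrite q0 scale0r add0r.
Qed.

End Basis.

(** * Uniformity on products of balls *)

Lemma ord_lower_bound (n : nat) (e : nat -> real) : (forall i, (i < n)%N -> 0 < e i) ->
  exists2 m : real, 0 < m & forall i, (i < n)%N -> m <= e i.
Proof.
elim: n => [|n IHn] e0; first by exists 1; rewrite ?ltr01.
have [|m m0 me] := IHn; first by move=> i ltin; apply: e0; rewrite ltnS ltnW.
exists (Num.min m (e n)); first by rewrite lt_min m0 e0.
move=> i; rewrite ltnS leq_eqVlt => /predU1P[->|ltin]; first by rewrite ge_min lexx orbT.
by rewrite ge_min me.
Qed.

Section RingNorm.
Context {R : nzRingType} {nrm : R -> real} (Rnorm : is_ring_norm nrm).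

Lemma nrm_ge0 a : 0 <= nrm a. Proof. by case: Rnorm => -[]. Qed.

Lemma nrm_eq0 a : nrm a = 0 -> a = 0.
Proof. by case: Rnorm => -[_ [_ [/(_ a 0) + _]]] _; rewrite subr0 => /[apply]. Qed.

Lemma nrm0 : nrm 0 = 0.
Proof. by case: Rnorm => -[_ [_ [/(_ 0 0) + _]]] _; rewrite subr0 => ->. Qed.

Lemma nrmM a b : nrm (a * b) <= nrm a * nrm b.
Proof. by case: Rnorm. Qed.

Lemma nrmN a : nrm (- a) = nrm a.
Proof. by case: Rnorm => -[_ [_ [_ [/(_ 0 a) + _]]]] _; rewrite sub0r subr0. Qed.

Lemma nrm_sub_le a b c : nrm (a - c) <= nrm (a - b) + nrm (b - c).
Proof. by case: Rnorm => -[_ [_ [_ [_ /(_ a b c)]]]]. Qed.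

Lemma nrmD a b : nrm (a + b) <= nrm a + nrm b.
Proof. by have := nrm_sub_le a 0 (- b); rewrite sub0r opprK subr0. Qed.

Lemma nrm_subC a b : nrm (a - b) = nrm (b - a).
Proof. by rewrite -nrmN opprB. Qed.

Hypothesis Rproper : proper_metric (fun r s : R => nrm (r - s)).

(* The tube lemma, by induction on the number of factors. *)
Lemma box_uniform (k : nat) (m : nat -> real) (P : (nat -> R) -> real -> Prop) :
  (forall r e e', 0 < e' -> e' <= e -> P r e -> P r e') ->
  (forall r, (forall i, (i < k)%N -> nrm (r i) <= m i) ->
    exists2 e, 0 < e &
      forall r', (forall i, (i < k)%N -> nrm (r i - r' i) < e) -> P r' e) ->
  exists2 e, 0 < e & forall r, (forall i, (i < k)%N -> nrm (r i) <= m i) -> P r e.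
Proof.
elim: k P => [|k IHk] P Pmono Ploc.
  have [//|e e0 Pe] := Ploc (fun=> 0).
  by exists e => // r _; apply: Pe.
pose upd (r : nat -> R) b := fun i => if i == k then b else r i.
(* [Q b] lets the last coordinate vary within [e] of [b]. For fixed [b] the induction hypothesis
   handles the other coordinates; compactness of the last ball then leaves finitely many [b]. *)
pose Q b r (e : real) := forall b', nrm (b - b') < e -> P (upd r b') e.
have Qunif b : nrm b <= m k -> exists2 e, 0 < e &
    forall r, (forall i, (i < k)%N -> nrm (r i) <= m i) -> Q b r e.
  move=> mb; apply: IHk => [r e e' e'0 lee' Qe b' bb'|r rm].
    by apply: (Pmono _ e) => //; apply: Qe; apply: lt_le_trans lee'.
  have [|e e0 Pe] := Ploc (upd r b).
    move=> i; rewrite /upd; case: eqP => [->//|/eqP nik].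
    by rewrite ltnS leq_eqVlt (negPf nik) => /rm.
  exists e => // r' rr' b' bb'; apply: Pe => i.
  rewrite /upd; case: eqP => [->//|/eqP nik].
  by rewrite ltnS leq_eqVlt (negPf nik) => /rr'.
have /choice[e eP] : forall b, exists e : real, 0 < e /\ (nrm b <= m k ->
    forall r, (forall i, (i < k)%N -> nrm (r i) <= m i) -> Q b r e).
  move=> b.
  have [mb|] := pselect (nrm b <= m k); last by exists 1; rewrite ltr01.
  by have [e e0 Qe] := Qunif b mb; exists e.
pose U (i : {b | nrm b <= m k}) : set R := [set y | nrm (sval i - y) < e (sval i)]%classic.
have Uopen i : mopen (fun r s : R => nrm (r - s)) (U i).
  move=> y Uy; exists (e (sval i) - nrm (sval i - y)); first by rewrite subr_gt0.
  by move=> z yz; rewrite /U /=; have := nrm_sub_le (sval i) y z; lra.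
have [|n [f fcov]] := Rproper 0 (m k) _ U Uopen.
  move=> b; rewrite /closed_ball_m /= sub0r nrmN => mb.
  by exists (exist _ b mb) => //; rewrite /U /= subrr nrm0; case: (eP b).
pose en i := if insub i is Some j then e (sval (f j)) else 1.
have [|e0 e0_gt0 e0P] := ord_lower_bound n en.
  by move=> i ltin; rewrite /en insubT; case: (eP (sval (f (Sub i ltin)))).
exists e0 => // r rm.
have /fcov[j _] : closed_ball_m (fun r s : R => nrm (r - s)) 0 (m k) (r k).
  by rewrite /closed_ball_m /= sub0r nrmN; apply: rm.
rewrite /U /= => Uj.
have -> : r = upd r (r k) by apply/funext => i; rewrite /upd; case: eqP => [->|].
apply: (Pmono _ (e (sval (f j)))) => //.
  have := e0P j (ltn_ord j); rewrite /en insubT; first exact: ltn_ord.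
  by move=> ltjn; rewrite (_ : Sub _ _ = j) //; apply: val_inj.
have [_ /(_ (svalP (f j)))] := eP (sval (f j)); apply=> // i ltik.
by apply: rm; rewrite ltnS ltnW.
Qed.

End RingNorm.

(** * The generic sequence *)

Section TopologicalModule.
Context {R : nzRingType} {nrm : R -> real} (Rnorm : is_ring_norm nrm).
Context {M : lmodType R} {dM : M -> M -> real}.
Hypotheses (Mmetric : is_metric dM) (Mtop : topological_module nrm dM).

Lemma dist_ge0 x y : 0 <= dM x y. Proof. by case: Mmetric. Qed.

Lemma distxx x : dM x x = 0. Proof. by case: Mmetric => _ [/(_ x x)[_ ->]]. Qed.

Lemma dist_eq0 x y : dM x y = 0 -> x = y.
Proof. by case: Mmetric => _ [/(_ x y)[]]. Qed.

Lemma distC x y : dM x y = dM y x. Proof. by case: Mmetric => _ [_ []]. Qed.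

Lemma dist_triangle y x z : dM x z <= dM x y + dM y z.
Proof. by case: Mmetric => _ [_ [_]]. Qed.

Lemma lin_sum_continuous n (x : nat -> M) r e : 0 < e ->
  exists2 del : real, 0 < del & forall r',
    (forall i, (i < n)%N -> nrm (r i - r' i) < del) ->
    dM (lin_sum n x r) (lin_sum n x r') < e.
Proof.
have [Madd [_ Mscale]] := Mtop.
elim: n e => [|n IHn] e e0.
  by exists 1; rewrite ?ltr01 // => r' _; rewrite /lin_sum !big_ord0 distxx.
have [d1 d10 addP] := Madd (lin_sum n x r) (r n *: x n) e e0.
have [d2 d20 sumP] := IHn d1 d10.
have [d3 d30 scaleP] := Mscale (r n) (x n) d1 d10.
exists (Num.min d2 d3); first by rewrite lt_min d20.
move=> r' rr'; rewrite !lin_sumS; apply: addP.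
  by apply: sumP => i ltin; have := rr' i (ltnW ltin); rewrite lt_min => /andP[].
apply: scaleP; last by rewrite distxx.
by have := rr' n (ltnSn n); rewrite lt_min => /andP[].
Qed.

(* If the span were a neighbourhood of 0, it would be an open subgroup, of
   countable index by separability. *)
Lemma small_nonspanned (N : submodClosed M) (Msep : separable_metric dM) :
  ~ countably_spanned N -> forall k (x : nat -> M) e, 0 < e ->
  exists y, dM 0 y < e /\ ~ span_mod N x k y.
Proof.
move=> Nspan k x e e0; apply: contrapT => noy; apply: Nspan.
have inspan y : dM 0 y < e -> span_mod N x k y.
  by move=> ye; apply: contrapT => ny; apply: noy; exists y.
(* [f] lists the first [k] vectors of [x] and then the dense sequence. *)
have [u udense] := Msep; pose f n := if (n < k)%N then x n else u (n - k)%N.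
exists f => y; have [Madd _] := Mtop.
(* Continuity at the pair of [y] and [- y] makes [u n - y] small, hence spanned by the first [k]
   vectors. *)
have [del del0 addP] := Madd y (- y) e e0.
have [n yn] := udense y del del0.
have : span_mod N x k (u n - y).
  by apply: inspan; rewrite -(subrr y); apply: addP; rewrite ?distxx.
move=> [c Nc]; exists (k + n).+1.
rewrite -[y](subrK (u n)) -opprB -scaleN1r.
apply: span_mod_linear.
  apply: (span_mod_widen _ _ k); first by rewrite -addnS leq_addr.
  by exists c; rewrite (eq_lin_sum _ f x c c) // => i ltik; rewrite /f ltik.
have -> : u n = f (k + n)%N by rewrite /f ltnNge leq_addr addKn.
exact: gen_span_mod.
Qed.

Lemma closed_seq_separated (C : nat -> set M) (Cclosed : forall n, mclosed dM (C n)) k y :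
  (forall m, (m < k)%N -> ~ C m y) ->
  exists2 e : real, 0 < e & forall m, (m < k)%N -> forall c, C m c -> e <= dM y c.
Proof.
move=> Cy.
have /choice[e eP] : forall m, exists e : real,
    0 < e /\ ((m < k)%N -> forall c, C m c -> e <= dM y c).
  move=> m; have [ltmk|] := ltnP m k; last by exists 1; rewrite ltr01.
  apply: contrapT => noe; apply: (Cy m ltmk); apply: Cclosed => e e0.
  apply: contrapT => noc; apply: noe; exists e; split=> // _ c Cc.
  by rewrite leNgt; apply/negP => yc; apply: noc; exists c.
have [|e0 e00 e0P] := ord_lower_bound k e; first by move=> i _; case: (eP i).
exists e0 => // m ltmk c Cc; apply: le_trans (e0P m ltmk) _.
by have [_ ->] := eP m.
Qed.

Context (N : submodClosed M) (C : nat -> set M).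
Hypothesis Rproper : proper_metric (fun r s : R => nrm (r - s)).
Hypotheses (Cclosed : forall n, mclosed dM (C n)) (CN : forall n c, C n c -> c \in N).

(** The radii grow with [k], so a sequence bounded by B times i! at each index i lies in every box
    with B <= [k]. *)
Definition in_box k (r : nat -> R) : Prop :=
  forall i, (i < k)%N -> nrm (r i) <= k%:R * i`!%:R.

(** For a single [r] this is continuity at [y = 0]; compactness of the box makes [del] independent
    of [r]. *)
Lemma small_perturbation k (x : nat -> M) e : 0 < e ->
  exists2 del : real, 0 < del & forall y r, dM 0 y < del -> in_box k.+1 r ->
    dM (lin_sum k x r) (lin_sum k x r + r k *: y) < e.
Proof.
move=> e0; have [Madd [_ Mscale]] := Mtop.
pose P (r : nat -> R) (del : real) := forall y, dM 0 y < del ->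
  dM (lin_sum k x r) (lin_sum k x r + r k *: y) < e.
suff [del del0 delP] : exists2 del, 0 < del & forall r, in_box k.+1 r -> P r del.
  by exists del => // y r yd /delP; apply.
apply: (box_uniform Rnorm Rproper) => [r d d' d'0 led' Pd y yd|r _].
  by apply: Pd; apply: lt_le_trans led'.
(* Both sums at a nearby [r'] are compared with the unperturbed sum at [r], each within [e / 2]. *)
have e20 : 0 < e / 2 by lra.
have [d1 d10 addP] := Madd (lin_sum k x r) 0 (e / 2) e20.
have [d2 d20 scaleP] := Mscale (r k) 0 d1 d10.
have [|d3 d30 sumP] := lin_sum_continuous k x r (Num.min d1 (e / 2)).
  by rewrite lt_min d10.
exists (Num.min d2 d3); first by rewrite lt_min d20.
move=> r' rr' y; rewrite lt_min => /andP[yd2 _].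
have {sumP} : dM (lin_sum k x r) (lin_sum k x r') < Num.min d1 (e / 2).
  by apply: sumP => i ltik; have := rr' i (ltnW ltik); rewrite lt_min => /andP[].
rewrite lt_min => /andP[Sd1 Se].
have : dM (lin_sum k x r + 0) (lin_sum k x r' + r' k *: y) < e / 2.
  apply: addP => //; rewrite -(scaler0 _ (r k)); apply: scaleP => //.
  by have := rr' k (ltnSn k); rewrite lt_min => /andP[].
rewrite addr0 => Sy.
have := dist_triangle (lin_sum k x r) (lin_sum k x r') (lin_sum k x r' + r' k *: y).
by rewrite (distC (lin_sum k x r') (lin_sum k x r)); lra.
Qed.

(** At a nonzero coefficient vector freeness keeps the sum outside [N], hence at positive distance
    from finitely many of the closed sets; compactness of the box makes the distance uniform. *)
Lemma free_separated k (x : nat -> M) : free_mod N k.+1 x ->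
  exists2 e : real, 0 < e & forall r, in_box k.+1 r ->
    (exists2 i, (i < k.+1)%N & k.+1%:R^-1 <= nrm (r i)) ->
    forall m, (m < k.+1)%N -> forall c, C m c -> e <= dM (lin_sum k.+1 x r) c.
Proof.
move=> freex.
pose P (r : nat -> R) (e : real) :=
  (exists2 i, (i < k.+1)%N & k.+1%:R^-1 <= nrm (r i)) ->
  forall m, (m < k.+1)%N -> forall c, C m c -> e <= dM (lin_sum k.+1 x r) c.
suff [e e0 eP] : exists2 e, 0 < e & forall r, in_box k.+1 r -> P r e by exists e.
apply: (box_uniform Rnorm Rproper) => [r e e' _ lee' Pe i0 m ltmk c Cc|r _].
  by apply: le_trans lee' _; apply: Pe Cc.
have [r0|r0] := pselect (forall i, (i < k.+1)%N -> r i = 0).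
  (* Within this radius of the zero vector no coordinate reaches the required size, so the claim is
     vacuous there. *)
  exists k.+1%:R^-1; first by rewrite invr_gt0 ltr0n.
  move=> r' rr' [i ltik]; have := rr' i ltik; rewrite r0 // sub0r (nrmN Rnorm).
  by rewrite ltNge => /negP.
have [|e e0 sepP] := closed_seq_separated C Cclosed k.+1 (lin_sum k.+1 x r).
  by move=> m _ /CN/freex.
have e20 : 0 < e / 2 by lra.
have [del del0 sumP] := lin_sum_continuous k.+1 x r _ e20.
exists (Num.min del (e / 2)); first by rewrite lt_min del0.
move=> r' rr' _ m ltmk c Cc; rewrite ge_min; apply/orP; right.
have := sepP m ltmk c Cc.
have := dist_triangle (lin_sum k.+1 x r') (lin_sum k.+1 x r) c.
have : dM (lin_sum k.+1 x r) (lin_sum k.+1 x r') < e / 2.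
  by apply: sumP => i ltik; have := rr' i ltik; rewrite lt_min => /andP[].
by lra.
Qed.

End TopologicalModule.

Arguments in_box {R} nrm k r.

(** * Inductive choice of the vectors and tolerances *)

Section GenericSequence.
Context {R : nzRingType} {nrm : R -> real}.
Hypotheses (Rdiv : is_division_ring R) (Rnorm : is_ring_norm nrm).
Hypothesis Rproper : proper_metric (fun r s : R => nrm (r - s)).
Context {M : lmodType R} {dM : M -> M -> real}.
Hypotheses (Mmetric : is_metric dM) (Mtop : topological_module nrm dM).
Hypothesis Msep : separable_metric dM.
Context (N : submodClosed M) (C : nat -> set M).
Hypotheses (Cclosed : forall n, mclosed dM (C n)) (CN : forall n c, C n c -> c \in N).
Hypothesis Nspan : ~ countably_spanned N.

(** With tolerances that at least halve at each stage, the divisor 4 makes all increments from stage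
    [k] on add up to at most half of the tolerance. *)
Definition step_small k (x : nat -> M) (e : real) : Prop :=
  forall r, in_box nrm k.+1 r ->
    dM (lin_sum k x r) (lin_sum k.+1 x r) < e / 4.

(** It is applied with the next tolerance [e k.+1], so the later increments use up at most half of
    the distance to the closed sets. *)
Definition step_separated k (x : nat -> M) (e : real) : Prop :=
  forall r, in_box nrm k.+1 r ->
    (exists2 i, (i < k.+1)%N & k.+1%:R^-1 <= nrm (r i)) ->
    forall m, (m < k.+1)%N -> forall c, C m c -> e <= dM (lin_sum k.+1 x r) c.

(** The new [y] is small enough for [small_perturbation] and outside the current span, which keeps
    the family free; [e'] is the resulting separation constant cut down to [e / 2]. *)
Lemma extend_sequence (s : seq M) (e : real) :
  free_mod N (size s) (nth 0 s) -> 0 < e ->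
  exists y e', let s' := rcons s y in
    [/\ free_mod N (size s).+1 (nth 0 s'), 0 < e', e' <= e / 2,
        step_small (size s) (nth 0 s') e & step_separated (size s) (nth 0 s') e'].
Proof.
set k := size s => free_s e0.
have e40 : 0 < e / 4 by lra.
have [del del0 delP] := small_perturbation Rnorm Mmetric Mtop Rproper k (nth 0 s) _ e40.
have [y [yd yspan]] := small_nonspanned Mmetric Mtop N Msep Nspan k (nth 0 s) del del0.
have nth_s i : (i < k)%N -> nth 0 (rcons s y) i = nth 0 s i.
  by move=> ltik; rewrite nth_rcons ltik.
have nth_y : nth 0 (rcons s y) k = y by rewrite nth_rcons ltnn eqxx.
have lin_s r : lin_sum k (nth 0 (rcons s y)) r = lin_sum k (nth 0 s) r.
  by apply: eq_lin_sum.
have free_s' : free_mod N k.+1 (nth 0 (rcons s y)).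
  apply: free_modS => // [r|]; first by rewrite lin_s; apply: free_s.
  by rewrite nth_y => -[c]; rewrite lin_s => yc; apply: yspan; exists c.
have [e1 e10 e1P] := free_separated Rnorm Mmetric Mtop N C Rproper Cclosed CN k _ free_s'.
exists y, (Num.min e1 (e / 2)); split=> //.
- by rewrite lt_min e10; lra.
- by rewrite ge_min lexx orbT.
- by move=> r rbox; rewrite lin_sumS nth_y lin_s; apply: delP.
move=> r rbox ri m ltmk c Cc.
by apply: le_trans (e1P r rbox ri m ltmk c Cc); rewrite ge_min lexx.
Qed.

Lemma generic_sequence : exists (x : nat -> M) (e : nat -> real), forall k,
  [/\ 0 < e k, e k.+1 <= e k / 2, step_small k x (e k) & step_separated k x (e k.+1)].
Proof.
(* A state is the list of vectors chosen so far with the current tolerance; the value [(0, 0)] below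
   is a default for states that are not [good]. *)
pose good (t : seq M * real) := free_mod N (size t.1) (nth 0 t.1) /\ 0 < t.2.
pose next (t : seq M * real) (p : M * real) := let s' := rcons t.1 p.1 in
    [/\ free_mod N (size t.1).+1 (nth 0 s'), 0 < p.2, p.2 <= t.2 / 2,
        step_small (size t.1) (nth 0 s') t.2 & step_separated (size t.1) (nth 0 s') p.2].
have /choice[F FP] : forall t, exists p, good t -> next t p.
  move=> t; have [[gt e0]|ngt] := pselect (good t); last by exists (0, 0).
  by have [y [e' nextP]] := extend_sequence t.1 t.2 gt e0; exists (y, e').
pose st := fix st n : seq M * real :=
  if n is n'.+1 then (rcons (st n').1 (F (st n')).1, (F (st n')).2) else ([::], 1).
have st_size n : size (st n).1 = n by elim: n => //= n IHn; rewrite size_rcons IHn.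
have st_good n : good (st n).
  elim: n => [|n IHn]; first by split=> [r _ i|] //=; rewrite ltr01.
  by have [free_n e0 _ _ _] := FP _ IHn; split=> //=; rewrite size_rcons.
(* Entry [i] is chosen at stage [i.+1] and kept by all later stages. *)
pose x i := nth 0 (st i.+1).1 i.
have st_nth n i : (i < n)%N -> nth 0 (st n).1 i = x i.
  elim: n => // n IHn; rewrite ltnS leq_eqVlt => /predU1P[->//|ltin].
  by rewrite /= nth_rcons st_size ltin IHn.
have lin_st k n r : (k <= n)%N -> lin_sum k (nth 0 (st n).1) r = lin_sum k x r.
  by move=> lekn; apply: eq_lin_sum => // i ltik; rewrite st_nth ?(leq_trans ltik).
exists x, (fun n => (st n).2) => k; have [_ e0] := st_good k.
have [_ _ e_half] := FP _ (st_good k); rewrite st_size => sm sp.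
split=> //.
  by move=> r /sm; rewrite -/((st k.+1).1) !(lin_st _ k.+1).
by move=> r /sp; rewrite -/((st k.+1).1) !(lin_st _ k.+1).
Qed.

End GenericSequence.

Arguments step_small {R} nrm {M} dM k x e.
Arguments step_separated {R} nrm {M} dM C k x e.

(** * The operator on l^1 *)

Section ExponentialSeries.
Import numFieldNormedType.Exports.

(** The series of 1/k! is the majorant that puts bounded sequences into l^1. *)
Lemma exp_coeff_summable (K : realType) :
  (\sum_(k <oo) (exp_coeff (1 : K) k)%:E < +oo)%E.
Proof.
have -> : (\sum_(k <oo) (exp_coeff (1 : K) k)%:E)%E =
    (limn (series (exp_coeff (1 : K))))%:E.
  rewrite -EFin_lim; last exact: is_cvg_series_exp_coeff.
  by apply/congr_lim/funext => n /=; rewrite sumEFin.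
by rewrite ltry.
Qed.

End ExponentialSeries.

Lemma exists_nat_ge (t : real) : exists n : nat, t <= n%:R.
Proof. by exists (Num.truncn t).+1; apply/ltW/truncnS_gt. Qed.

(** * Factorial bounds and membership in l^1 *)

Section SummableSequences.
Context {R : nzRingType} {nrm : R -> real} (Rnorm : is_ring_norm nrm).

(** Convergence of the sums rests on this bound alone; for elements of l^1 the norm serves as
    [B]. *)
Definition fact_bounded (B : real) (r : nat -> R) : Prop :=
  forall i, nrm (r i) <= B * i`!%:R.

Lemma l1_terms_ge0 r k : 0 <= l1_terms nrm r k.
Proof. by rewrite divr_ge0 ?(nrm_ge0 Rnorm) ?ler0n. Qed.

Lemma l1_fact_bounded r : in_l1 nrm r -> fact_bounded (l1_norm nrm r) r.
Proof.
move=> r1 k; rewrite -ler_pdivrMr ?ltr0n ?fact_gt0 // -/(l1_terms nrm r k).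
have terms_ge0 i : (0 <= (l1_terms nrm r i)%:E)%E by rewrite lee_fin l1_terms_ge0.
rewrite -lee_fin /l1_norm fineK; last first.
  by rewrite ge0_fin_numE // nneseries_ge0.
apply: le_trans (nneseries_lim_ge k.+1 _) => //.
by rewrite big_nat_recr //= leeDr // sume_ge0.
Qed.

Lemma in_l1_linear a r s : in_l1 nrm r -> in_l1 nrm s ->
  in_l1 nrm (fun k => a * r k + s k).
Proof.
move=> r1 s1.
have terms_ge0 u i : (0 <= (l1_terms nrm u i)%:E)%E by rewrite lee_fin l1_terms_ge0.
apply: (@le_lt_trans _ _
  (\sum_(k <oo) ((nrm a)%:E * (l1_terms nrm r k)%:E + (l1_terms nrm s k)%:E))%E).
  apply: lee_nneseries => // k _; rewrite -EFinM -EFinD lee_fin /l1_terms mulrA -mulrDl.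
  rewrite ler_wpM2r ?invr_ge0 ?ler0n //.
  by apply: le_trans (nrmD Rnorm _ _) _; rewrite lerD2r (nrmM Rnorm).
rewrite nneseriesD // ?nneseriesZl //.
  by rewrite lte_add_pinfty // lte_mul_pinfty // lee_fin (nrm_ge0 Rnorm).
by move=> i _ _; rewrite mule_ge0 // lee_fin (nrm_ge0 Rnorm).
Qed.

Lemma bounded_in_l1 B r : (forall k, nrm (r k) <= B) -> in_l1 nrm r.
Proof.
move=> rB; have B0 : 0 <= B := le_trans (nrm_ge0 Rnorm _) (rB 0).
apply: (@le_lt_trans _ _ (\sum_(k <oo) (B%:E * (exp_coeff (1 : real) k)%:E))%E).
  apply: lee_nneseries => [k _ _|k _]; first by rewrite lee_fin l1_terms_ge0.
  rewrite -EFinM lee_fin /exp_coeff /= expr1n mul1r.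
  by rewrite ler_wpM2r ?invr_ge0 ?ler0n.
rewrite nneseriesZl => [|k _]; last by rewrite lee_fin exp_coeff_ge0.
by rewrite lte_mul_pinfty // exp_coeff_summable.
Qed.

End SummableSequences.

Arguments fact_bounded {R} nrm B r.

(** * Limits of the partial sums and the resulting embedding *)

Section Operator.
Context {R : nzRingType} {nrm : R -> real} (Rnorm : is_ring_norm nrm).
Context {M : lmodType R} {dM : M -> M -> real}.
Hypotheses (Mmetric : is_metric dM) (Mtop : topological_module nrm dM).
Hypothesis Mcomplete : complete_metric dM.

Definition tends (u : nat -> M) (l : M) : Prop :=
  forall e : real, 0 < e -> exists n, forall m, (n <= m)%N -> dM l (u m) < e.

Lemma tends_unique u l l' : tends u l -> tends u l' -> l = l'.
Proof.
move=> ul ul'; apply: (dist_eq0 Mmetric); apply/eqP.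
rewrite eq_le (dist_ge0 Mmetric) andbT; apply/ler_addgt0Pr => e e0.
have e20 : 0 < e / 2 by lra.
have [n nP] := ul _ e20; have [m mP] := ul' _ e20.
have := nP _ (leq_maxl n m); have := mP _ (leq_maxr n m).
have := dist_triangle Mmetric (u (maxn n m)) l l'.
by rewrite (distC Mmetric (u _) l'); lra.
Qed.

Lemma tends_linear a u v l l' : tends u l -> tends v l' ->
  tends (fun n => a *: u n + v n) (a *: l + l').
Proof.
have [Madd [_ Mscale]] := Mtop; move=> ul vl' e e0.
have [d1 d10 addP] := Madd (a *: l) l' e e0.
have [d2 d20 scaleP] := Mscale a l d1 d10.
have [n nP] := ul d2 d20; have [m mP] := vl' d1 d10.
exists (maxn n m) => k; rewrite geq_max => /andP[nk mk].
by apply: addP (mP k mk); apply: scaleP (nP k nk); rewrite subrr (nrm0 Rnorm).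
Qed.

Context (N : submodClosed M) (C : nat -> set M).
Hypothesis NC : forall y, y \in N -> exists n, C n y.
Context (x : nat -> M) (e : nat -> real).
Hypotheses (e_gt0 : forall k, 0 < e k) (e_half : forall k, e k.+1 <= e k / 2).
Hypothesis x_small : forall k, step_small nrm dM k x (e k).
Hypothesis x_sep : forall k, step_separated nrm dM C k x (e k.+1).

Lemma e_small d : 0 < d -> exists n, forall k, (n <= k)%N -> e k < d.
Proof.
(* Halving is weakened to decay of order 1/k, since k+2 <= 2(k+1). *)
move=> d0; have ek k : k.+1%:R * e k <= e 0%N.
  elim: k => [|k IHk]; first by rewrite mul1r.
  apply: le_trans IHk; rewrite -[k.+2]addn1 natrD.
  have := e_half k; have := e_gt0 k; have := e_gt0 k.+1.
  have : (1 : real) <= k.+1%:R by rewrite ler1n.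
  by nra.
have [n en] := exists_nat_ge (e 0%N / d).
exists n => k lenk; rewrite -(ltr_pM2l (x := k.+1%:R)) ?ltr0n //.
apply: le_lt_trans (ek k) _; move: en; rewrite ler_pdivrMr // => en.
by apply: le_lt_trans en _; rewrite ltr_pM2r // ltr_nat.
Qed.

Lemma fact_bounded_box B r k : B <= k%:R -> fact_bounded nrm B r ->
  in_box nrm k r.
Proof.
move=> Bk rB i _; apply: le_trans (rB i) _.
by rewrite ler_wpM2r ?ler0n.
Qed.

(* The step-size bound [e k / 4] is at most [(e k - e k.+1) / 2], so the
   distances telescope. *)
Lemma lin_sum_near B r k n : fact_bounded nrm B r -> B <= k%:R ->
  (k <= n)%N -> dM (lin_sum k x r) (lin_sum n x r) <= e k / 2.
Proof.
move=> rB Bk lekn.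
suff : dM (lin_sum k x r) (lin_sum n x r) <= (e k - e n) / 2.
  by have := e_gt0 n; lra.
rewrite -(subnKC lekn); elim: (n - k)%N => [|j IHj].
  by rewrite addn0 (distxx Mmetric) subrr mul0r.
rewrite addnS.
have : in_box nrm (k + j).+1 r.
  apply: fact_bounded_box rB; apply: le_trans Bk _.
  by rewrite ler_nat -addnS leq_addr.
move=> /x_small.
have := dist_triangle Mmetric (lin_sum (k + j) x r) (lin_sum k x r) (lin_sum (k + j).+1 x r).
have := e_half (k + j).
by lra.
Qed.

Lemma lin_sum_tends B r : fact_bounded nrm B r ->
  exists l, tends (fun n => lin_sum n x r) l.
Proof.
move=> rB; apply: Mcomplete => d d0.
have [n nP] := e_small d d0.
have [b Bb] := exists_nat_ge B; pose k := maxn n b.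
have Bk : B <= k%:R by apply: le_trans Bb _; rewrite ler_nat leq_maxr.
exists k => i j ki kj; have := nP k (leq_maxl _ _).
have := lin_sum_near B r k i rB Bk ki; have := lin_sum_near B r k j rB Bk kj.
have := dist_triangle Mmetric (lin_sum k x r) (lin_sum i x r) (lin_sum j x r).
by rewrite (distC Mmetric (lin_sum i x r) (lin_sum k x r)); lra.
Qed.

Lemma lin_sum_limit_near B r k l : fact_bounded nrm B r -> B <= k%:R ->
  tends (fun n => lin_sum n x r) l -> dM (lin_sum k x r) l <= e k / 2.
Proof.
move=> rB Bk rl; apply/ler_addgt0Pr => d d0; have [n nP] := rl d d0.
have := nP _ (leq_maxl n k); have := lin_sum_near B r k _ rB Bk (leq_maxr n k).
have := dist_triangle Mmetric (lin_sum (maxn n k) x r) (lin_sum k x r) l.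
by rewrite (distC Mmetric (lin_sum (maxn n k) x r) l); lra.
Qed.

(** If the limit lay in some [C m], take [k] beyond [B], the inverse of [nrm (r i)], [i] and [m]:
    the partial sum of length [k.+1] is at distance at least [e k.+1] from [C m], yet within half of
    that from the limit. *)
Lemma limit_notin_N B r l i : fact_bounded nrm B r -> r i != 0 ->
  tends (fun n => lin_sum n x r) l -> l \notin N.
Proof.
move=> rB ri rl; apply/negP => /NC[m Cm].
have ri0 : 0 < nrm (r i).
  rewrite lt_def (nrm_ge0 Rnorm) andbT; apply: contraNneq ri => /(nrm_eq0 Rnorm)->.
  exact: eqxx.
have [b Bb] := exists_nat_ge B; have [c cr] := exists_nat_ge (nrm (r i))^-1.
pose k := (b + c + i + m)%N.
have Bk : B <= k.+1%:R by apply: le_trans Bb _; rewrite ler_nat /k; lia.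
have rik : k.+1%:R^-1 <= nrm (r i).
  rewrite -[leRHS]invrK lef_pV2 ?posrE ?invr_gt0 ?ltr0n //.
  by apply: le_trans cr _; rewrite ler_nat /k; lia.
have : e k.+1 <= dM (lin_sum k.+1 x r) l.
  apply: (x_sep k r _ _ m) => //; last by rewrite /k; lia.
    exact: fact_bounded_box rB.
  by exists i; rewrite // /k; lia.
have := lin_sum_limit_near B r _ l rB Bk rl; have := e_gt0 k.+1.
by lra.
Qed.

Lemma generic_l1_embeds : l1_embeds nrm dM N.
Proof.
(* Outside l^1 the value of [T] is set to 0. *)
have /choice[T TP] : forall r, exists l,
    in_l1 nrm r -> tends (fun n => lin_sum n x r) l.
  move=> r; have [r1|] := pselect (in_l1 nrm r); last by exists 0.
  by have [l rl] := lin_sum_tends _ _ (l1_fact_bounded Rnorm r r1); exists l.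
have T_linear a r s : in_l1 nrm r -> in_l1 nrm s ->
    T (fun k => a * r k + s k) = a *: T r + T s.
  move=> r1 s1; have := TP _ (in_l1_linear Rnorm a r s r1 s1).
  move=> /tends_unique; apply.
  under eq_fun do rewrite lin_sum_linear.
  exact: tends_linear (TP _ r1) (TP _ s1).
have sub_l1 r s : in_l1 nrm r -> in_l1 nrm s -> in_l1 nrm (fun k => r k - s k).
  move=> r1 s1; have := in_l1_linear Rnorm (- 1) s r s1 r1.
  by under eq_fun do rewrite mulN1r addrC.
exists T; split=> [//|r r1 d d0|r s r1 s1 NTrs].
  set B := l1_norm nrm r; have rB := l1_fact_bounded Rnorm r r1.
  have d20 : 0 < d / 2 by lra.
  have [n nP] := e_small _ d20.
  have [b Bb] := exists_nat_ge (B + 1); pose k := maxn n b.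
  have Bk : B + 1 <= k%:R by apply: le_trans Bb _; rewrite ler_nat leq_maxr.
  have ek := nP k (leq_maxl _ _).
  have [del del0 delP] := lin_sum_continuous Mmetric Mtop k x r (d / 2) d20.
  (* The bound 1 keeps [s] factorially bounded by [B + 1]; the other bound brings the first [k]
     coordinates within [del], as i! <= k! for i < k. *)
  exists (Num.min 1 (del / k`!%:R)).
    by rewrite lt_min ltr01 divr_gt0 ?ltr0n ?fact_gt0.
  move=> s s1; rewrite lt_min => /andP[rs_1 rs_del].
  have rsB := l1_fact_bounded Rnorm _ (sub_l1 r s r1 s1).
  set D := l1_norm nrm _ in rs_1 rs_del rsB.
  have sB : fact_bounded nrm (B + 1) s.
    move=> i; have := nrm_sub_le Rnorm (s i) (r i) 0; rewrite !subr0 => s_le.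
    have := rB i; have : nrm (s i - r i) <= D * i`!%:R.
      by rewrite (nrm_subC Rnorm); apply: rsB.
    have : D * i`!%:R <= i`!%:R by rewrite ger_pMl ?ltr0n ?fact_gt0 // ltW.
    by rewrite mulrDl mul1r -/B; lra.
  have rB1 : fact_bounded nrm (B + 1) r.
    move=> i; apply: le_trans (rB i) _.
    by rewrite ler_wpM2r ?ler0n // lerDl.
  have := lin_sum_limit_near _ _ _ _ rB1 Bk (TP r r1).
  have := lin_sum_limit_near _ _ _ _ sB Bk (TP s s1).
  have : dM (lin_sum k x r) (lin_sum k x s) < d / 2.
    apply: delP => i ltik; apply: le_lt_trans (rsB i) _.
    move: rs_del; rewrite ltr_pdivlMr ?ltr0n ?fact_gt0 //; apply: le_lt_trans.
    have D0 : 0 <= D.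
      by have := rsB 0%N; rewrite mulr1; apply: le_trans; apply: nrm_ge0.
    apply: (ler_wpM2l D0); rewrite ler_nat; apply: dvdn_leq (fact_gt0 k) _.
    by rewrite (fact_split (ltnW ltik)) dvdn_mulr.
  (* The two tails contribute less than [d / 4] each, the finite sums less than [d / 2]. *)
  have := dist_triangle Mmetric (lin_sum k x r) (T r) (T s).
  have := dist_triangle Mmetric (lin_sum k x s) (lin_sum k x r) (T s).
  by rewrite (distC Mmetric (T r) (lin_sum k x r)); lra.
apply/funext => i; apply/eqP; rewrite -subr_eq0; apply/negPn/negP => rsi.
have rs1 := in_l1_linear Rnorm (- 1) s r s1 r1.
have rs1i : - 1 * s i + r i != 0 by rewrite mulN1r addrC.
have := limit_notin_N _ _ _ i (l1_fact_bounded Rnorm _ rs1) rs1i (TP _ rs1).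
by rewrite T_linear // scaleN1r [- T s + T r]addrC NTrs.
Qed.

End Operator.

(** * Incompatibility of the two alternatives *)

Section PrefixIndicators.
Context {R : nzRingType}.

(** Coordinates are read as codes of finite binary words. Distinct sequences share only finitely
    many prefixes, whence the independence. *)
Definition prefix_indicator (A : nat -> bool) (k : nat) : R :=
  if unpickle k is Some s then (s == mkseq A (size (s : seq bool)))%:R else 0.

Lemma prefix_indicator_pickle A B n :
  prefix_indicator A (pickle (mkseq B n)) = (mkseq B n == mkseq A n)%:R.
Proof. by rewrite /prefix_indicator pickleK size_mkseq. Qed.

Lemma mkseq_separates n (A : 'I_n -> nat -> bool) (i : 'I_n) : injective A ->
  exists L, forall j, j != i -> mkseq (A i) L != mkseq (A j) L.
Proof.
move=> Ainj.
have /choice[t tP] : forall j, exists t, j != i -> A i t != A j t.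
  move=> j; have [->|ji] := eqVneq j i; first by exists 0.
  apply: contrapT => nt; move/eqP: ji; apply; apply: Ainj; apply/funext => t.
  by apply/eqP/negPn/negP => ijt; apply: nt; exists t => _; rewrite eq_sym.
(* A prefix must have length at least [(t j).+1] to contain position [t j]. *)
exists (\max_j (t j).+1)%N => j ji; apply: contraNneq (tP j ji) => eqA.
have ltL : (t j < \max_j (t j).+1)%N by apply: (leq_bigmax (F := fun j => (t j).+1)).
by rewrite -(nth_mkseq false (A i) ltL) eqA nth_mkseq.
Qed.

(** Evaluation at the code of a prefix that [A i] shares with no other [A j] isolates [a i]. *)
Lemma prefix_indicator_free n (A : 'I_n -> nat -> bool) (a : 'I_n -> R) :
  injective A -> (forall k, \sum_i a i * prefix_indicator (A i) k = 0) ->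
  forall i, a i = 0.
Proof.
move=> Ainj a0 i; have [L LP] := mkseq_separates n A i Ainj.
have := a0 (pickle (mkseq (A i) L)); rewrite (bigD1 i) //=.
rewrite prefix_indicator_pickle eqxx mulr1 big1 ?addr0 // => j ji.
by rewrite prefix_indicator_pickle (negPf (LP j ji)) mulr0.
Qed.

End PrefixIndicators.

(** Cantor's diagonal argument, with [D] the diagonal sequence. *)
Lemma binary_sequences_uncountable (f : (nat -> bool) -> nat) : ~ injective f.
Proof.
move=> finj.
pose D n := `[< exists A, f A = n /\ ~~ A n >].
have [Df|/negP nDf] := boolP (D (f D)).
  by have /asboolP[A [/finj->]] := Df => /negP.
by apply: (nDf); apply/asboolP; exists D; split=> //; apply/negP.
Qed.

(** * An embedding of l^1 rules out a countable spanning family *)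

Section Exclusion.
Context {R : nzRingType} {nrm : R -> real}.
Hypotheses (Rdiv : is_division_ring R) (Rnorm : is_ring_norm nrm).
Context {M : lmodType R} (dM : M -> M -> real) (N : submodClosed M).

Lemma prefix_indicator_l1 A : in_l1 nrm (prefix_indicator A).
Proof.
apply: (bounded_in_l1 Rnorm (nrm 1)) => k; rewrite /prefix_indicator.
case: unpickle => [s|]; last by rewrite (nrm0 Rnorm) (nrm_ge0 Rnorm).
by case: (_ == _); rewrite ?(nrm0 Rnorm) ?(nrm_ge0 Rnorm).
Qed.

(** Modulo [N], [n] generators cannot span [n.+1] independent vectors, so each [E n] is finite. If
    these sets exhausted the binary sequences, there would be only countably many. *)
Lemma l1_embeds_not_countably_spanned :
  l1_embeds nrm dM N -> ~ countably_spanned N.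
Proof.
move=> [T [T_linear _ Tinj]] [f spanf].
have l10 : in_l1 nrm (fun=> 0).
  by apply: (bounded_in_l1 Rnorm 0) => k; rewrite (nrm0 Rnorm).
have T0 : T (fun=> 0) = 0.
  have := T_linear 1 _ _ l10 l10; under eq_fun do rewrite mulr0 addr0.
  by rewrite scale1r -[LHS]addr0 => /addrI.
pose E n := [set A | span_mod N f n (T (prefix_indicator A))]%classic.
suff Efin n : finite_set (E n).
  have /countable_injP[g ginj] : countable [set: nat -> bool].
    apply: (sub_countable (B := \bigcup_(n in [set: nat]) E n)%classic).
      apply: subset_card_le => A _; have [n An] := spanf (T (prefix_indicator A)).
      by exists n.
    by apply: bigcup_countable => // n _; apply: finite_set_countable.
  by apply: (binary_sequences_uncountable g) => A B; apply: ginj; rewrite inE.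
apply: contrapT => /infiniteP/pcard_leP[A].
pose Ai (i : 'I_n.+1) := A i : nat -> bool.
have Ainj : injective Ai.
  by move=> i j /(inj (f := A)) ij; apply/val_inj/ij; rewrite inE.
have /choice[c cP] : forall i : 'I_n.+1, exists c : nat -> R,
    T (prefix_indicator (Ai i)) - lin_sum n f c \in N.
  by move=> i; have := @funS _ _ _ _ A i I.
(* The relation [a] cancels every generator, so the same combination of the images under [T] falls
   into [N]. *)
have [|a [[i _ ai] aP]] := exists_left_relation Rdiv _ n [set: 'I_n.+1] c.
  by rewrite cardsT card_ord.
have T_sum (s : seq 'I_n.+1) :
    in_l1 nrm (fun k => \sum_(i <- s) a i * prefix_indicator (Ai i) k) /\
    T (fun k => \sum_(i <- s) a i * prefix_indicator (Ai i) k) =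
    \sum_(i <- s) a i *: T (prefix_indicator (Ai i)).
  elim: s => [|j s [s1 Ts]].
    by under eq_fun do rewrite big_nil; rewrite big_nil T0.
  under eq_fun do rewrite big_cons; rewrite big_cons -Ts T_linear //.
    by split=> //; apply: in_l1_linear => //; apply: prefix_indicator_l1.
  exact: prefix_indicator_l1.
have lin0 : \sum_i a i *: lin_sum n f (c i) = 0.
  rewrite /lin_sum; under eq_bigr do rewrite scaler_sumr.
  rewrite exchange_big big1 //= => j _.
  under eq_bigr do rewrite scalerA.
  rewrite -scaler_suml; have := aP j (ltn_ord j).
  by under eq_bigl do rewrite inE; move=> ->; rewrite scale0r.
have [s1 Ts] := T_sum (index_enum 'I_n.+1).
have TN : T (fun k => \sum_i a i * prefix_indicator (Ai i) k) - T (fun=> 0) \in N.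
  rewrite T0 Ts -[X in _ - X]lin0 -sumrB; apply: rpred_sum => j _.
  by rewrite -scalerBr rpredZ.
case/eqP: ai; apply: prefix_indicator_free Ainj _ i => k.
exact: (congr1 (@^~ k) (Tinj _ _ s1 l10 TN)).
Qed.

End Exclusion.

Theorem theorem5p1 (R : nzRingType) (nrm : R -> real)
    (Rdiv : is_division_ring R) (Rnorm : is_ring_norm nrm)
    (Rproper : proper_metric (fun r s : R => nrm (r - s)))
    (M : lmodType R) (dM : M -> M -> real) (MPolish : polish_module nrm dM)
    (N : {pred M}) (Nsub : submod_closed N) (NFsigma : Fsigma dM (fun x => x \in N)) :
  (countable_dim_quot N \/ l1_embeds nrm dM N) /\
  ~ (countable_dim_quot N /\ l1_embeds nrm dM N).
Proof.
have [Mmetric Mcomplete Msep Mtop] := MPolish.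
(* The predicate is bundled with its closure properties so that the lemmas on submodules apply. *)
pose N' : submodClosed M := HB.pack N (GRing.isSubmodClosed.Build R M N Nsub).
have [C [Cclosed NC]] := NFsigma.
have NP y : y \in N <-> exists n, C n y.
  have -> : (y \in N) = (\bigcup_(n in [set: nat]) C n)%classic y :> Prop.
    by rewrite -NC.
  by split=> [[n _ Cy]|[n Cy]]; exists n.
rewrite -[N]/(N' : {pred M}); split; last first.
  move=> [/countable_dim_countably_spanned Nspan /l1_embeds_not_countably_spanned].
  exact.
(* A countable spanning family yields a countable basis; its absence feeds the inductive
   construction. *)
have [/countably_spanned_countable_dim|Nspan] := pselect (countably_spanned N').
  by move=> /(_ Rdiv); left.
right.
have CN n y : C n y -> y \in N' by move=> Cy; apply/NP; exists n.
have [x [e xe]] :=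
  generic_sequence Rdiv Rnorm Rproper Mmetric Mtop Msep N' C Cclosed CN Nspan.
apply: (generic_l1_embeds Rnorm Mmetric Mtop Mcomplete N' C _ x e) => [y /NP//|k|k|k|k];
  by have [] := xe k.
Qed.
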